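(* Let $D$ be a strongly connected directed graph (multiple edges allowed) with a fixed cyclic ordering of the out-edges at each vertex. Then for every vertex $w$ of $D$, the number of rotor-router unicycle-orbits of $D$ equals $\frac{\mathcal{T}(D,w)}{{\rm per}_D(w)}$.
   Context: At each vertex $v$ a cyclic ordering of the outgoing edges is fixed; for an edge $e$ with tail $v$, $e^+$ is the next edge in this order. A rotor configuration $\varrho$ assigns to each vertex $v$ an out-edge $\varrho(v)$ with tail $v$. A chip-and-rotor configuration is a pair $(w,\varrho)$ with $w$ a vertex. The rotor-router operation sends $(w,\varrho)$ to $(w^+,\varrho^+)$ with $\varrho^+(v)=\varrho(v)$ for $v\ne w$, $\varrho^+(w)=\varrho(w)^+$, and $w^+$ the head of $\varrho^+(w)$. A unicycle is a chip-and-rotor configuration $(w,\varrho)$ such that $\{\varrho(v)\}$ contains a unique directed cycle and $w$ lies on it; for strongly connected $D$ the rotor-router operation permutes the unicycles, and unicycle-orbits are the orbits of this permutation. Identify $V$ with $\{1,\dots,n\}$; the Laplacian $L_D$ has $L_D(i,i)=-d^+(i)$ and $L_D(i,j)=d(j,i)$ (number of edges from $j$ to $i$) for $i\ne j$. ${\rm per}_D$ is the unique vector in $\mathbb{Z}^n$ with positive entries having no nontrivial common divisor such that $L_D\,{\rm per}_D=0$. $\mathcal{T}(D,w)$ is the number of spanning in-arborescences of $D$ rooted at $w$, i.e. spanning acyclic subdigraphs in which every vertex $v\ne w$ has a unique directed path to $w$ (every vertex other than $w$ has out-degree one, $w$ has out-degree zero). *)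

(* Defs.v *)
From HB Require Import structures.
From mathcomp Require Import all_boot all_order all_algebra.

Set Implicit Arguments.
Unset Strict Implicit.
Unset Printing Implicit Defensive.

Import Order.TTheory GRing.Theory Num.Theory.
Local Open Scope ring_scope.

Record digraph (n : nat) := Digraph {
  edge : finType;
  tail : edge -> 'I_n;
  head : edge -> 'I_n
}.

Section Digraph.
Variables (n : nat) (D : digraph n).
Local Notation E := (edge D).
Implicit Types (u v w : 'I_n) (e f : E) (A C P : {set E}).

Definition mult u v : nat := #|[set e : E | (tail e == u) && (head e == v)]|.

Definition outdeg v : nat := #|[set e : E | tail e == v]|.

Definition strongly_connected : Prop :=
  forall u v, connect (fun x y => 0 < mult x y)%N u v.

(* Directed cycles and (simple) directed paths are subdigraphs, given by their
   edge sets; an enumeration of the edges in the order of traversal has length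
   #|C| (resp. #|P|) because vertices are not repeated. *)
Definition dicycle C : bool :=
  [exists p : #|C|.-tuple E,
     [&& C != set0, C == [set e in p],
         cycle (fun e f => head e == tail f) p & uniq [seq tail e | e <- p]]].

Fixpoint walk v (p : seq E) : bool :=
  if p is e :: q then (tail e == v) && walk (head e) q else true.

Definition dipath v w P : bool :=
  [exists p : #|P|.-tuple E,
     [&& P == [set e in p], walk v p, last v [seq head e | e <- p] == w
       & uniq (v :: [seq head e | e <- p])]].

Definition acyclic A : bool :=
  [forall C : {set E}, (C \subset A) ==> ~~ dicycle C].

(* The degree conditions follow from the first two. *)
Definition in_arborescence w A : bool :=
  [&& acyclic A,
      [forall v, (v != w) ==>
        (#|[set P : {set E} | (P \subset A) && dipath v w P]| == 1%N)]
    & [forall v, #|[set e in A | tail e == v]| == (v != w)]].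

Definition num_arborescences w : nat :=
  #|[set A : {set E} | in_arborescence w A]|.

Definition laplacian : 'M[int]_n :=
  \matrix_(i, j) (if i == j then - (outdeg i)%:Z else (mult j i)%:Z).

Definition is_per (p : 'cV[int]_n) : Prop :=
  [/\ forall v, 0 < p v 0,
      forall d : int, (forall v, (d %| p v ord0)%Z) -> `|d| = 1
    & laplacian *m p = 0].

(* A cyclic ordering of the out-edges at every vertex, given by its successor
   function e |-> e^+: the orbit of e is the set of all edges with the same
   tail as e, so the function cycles through the out-edges of each vertex. *)
Definition cyclic_ordering (next : E -> E) : Prop :=
  forall e f, fconnect next e f = (tail f == tail e).

Definition chip_rotor : finType := ('I_n * {ffun 'I_n -> E})%type.

Definition rotor_config (rho : {ffun 'I_n -> E}) : bool :=
  [forall v, tail (rho v) == v].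

Definition rotor_router (next : E -> E) (c : chip_rotor) : chip_rotor :=
  let: (w, rho) := c in
  (head (next (rho w)), [ffun v => if v == w then next (rho w) else rho v]).

Definition rotor_cycles (rho : {ffun 'I_n -> E}) : {set {set E}} :=
  [set C : {set E} | (C \subset [set rho v | v : 'I_n]) && dicycle C].

Definition unicycle (c : chip_rotor) : bool :=
  let: (w, rho) := c in
  rotor_config rho &&
  [exists C : {set E},
     (rotor_cycles rho == [set C]) && (w \in [set tail e | e in C])].

(* The operation permutes the finite set of unicycles of a strongly connected
   digraph, so that forward iterates describe the whole orbit. *)
Definition rr_orbit (next : E -> E) (c : chip_rotor) : {set chip_rotor} :=
  [set c' | fconnect (rotor_router next) c c'].

Definition unicycle_orbits (next : E -> E) : {set {set chip_rotor}} :=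
  [set rr_orbit next c | c in unicycle].

End Digraph.

(* Main.v *)
(* Call a pair (w, rho) rooted when the rotors lead from every vertex to w;
   these are exactly the unicycles, and deleting rho(w) turns them into the
   spanning in-arborescences rooted at w.  Let N be the sum over v of
   per(v) outdeg(v).  A run of N steps from a unicycle makes every vertex v
   complete exactly per(v) turns: the first vertex to exceed its quota can only
   be the starting vertex, and a vertex still short of its quota would propagate
   its deficit along the initial rotors to that vertex.  So the period divides N;
   the quotient divides every per(v), hence is 1.  Every orbit therefore contains
   exactly per(w) unicycles whose chip is at w with a prescribed rotor at w, while
   there are T(D, w) such unicycles in all. *)
Require Import Defs.
From HB Require Import structures.
From mathcomp Require Import all_boot all_order all_algebra.

Set Implicit Arguments.
Unset Strict Implicit.
Unset Printing Implicit Defensive.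

Import Order.TTheory GRing.Theory Num.Theory.
Local Open Scope ring_scope.
Local Open Scope nat_scope.

(** * Orbits of a self-map of a finite type *)

Section PeriodicIteration.
Variables (T : finType) (f : T -> T).

Lemma iter_mul_period m k x : iter k f x = x -> iter (m * k) f x = x.
Proof.
by move=> fx; elim: m => // m IHm; rewrite mulSn iterD IHm.
Qed.

(** Iterates below the order are pairwise distinct, so the remainder of [k] modulo the order must be
    0. *)
Lemma order_dvd_iter k x : iter k f x = x -> order f x %| k.
Proof.
have [-> //|k_gt0 kx] := posnP k.
have ox : iter (order f x) f x = x.
  by apply/(orbitPcycle 3 4); exists k.-1; rewrite prednK.
move: kx; rewrite {1}(divn_eq k (order f x)) addnC iterD iter_mul_period // => rx.
have lt_r : k %% order f x < order f x by rewrite ltn_mod order_gt0.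
by have := findex_iter lt_r; rewrite rx findex0 => /esym/eqP.
Qed.

(** Over one period, the iterates of a periodic point run through its orbit exactly once. *)
Lemma sum_iter_order (P : pred T) m x :
  iter (order f x) f x = x ->
  \sum_(k < m * order f x) P (iter k f x) = m * #|[pred y in fconnect f x | P y]|.
Proof.
move=> ox; elim: m => [|m IHm]; first by rewrite big_ord0.
rewrite !mulSn big_split_ord /=; congr (_ + _); last first.
  by rewrite -IHm; apply: eq_bigr => i _; rewrite addnC iterD ox.
rewrite -(big_mkord xpredT (fun k => nat_of_bool (P (iter k f x)))).
have orbitE : orbit f x = [seq iter k f x | k <- index_iota 0 (order f x)].
  apply: (@eq_from_nth _ x) => [|i].
    by rewrite size_orbit size_map size_iota subn0.
  rewrite size_orbit => lt_i; rewrite nth_traject // (nth_map 0) ?size_iota ?subn0 //.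
  by rewrite nth_iota ?subn0 // add0n.
rewrite -(big_map _ xpredT (fun y => nat_of_bool (P y))) -orbitE.
rewrite -big_mkcond sum1_count -size_filter.
rewrite -(card_uniqP (filter_uniq _ (orbit_uniq f x))).
by apply: eq_card => y; rewrite !inE mem_filter -fconnect_orbit andbC.
Qed.

End PeriodicIteration.

(** * Rotor configurations as functional graphs; unicycles *)

Section RotorGraph.
Variables (n : nat) (D : digraph n).
Local Notation E := (edge D).
Implicit Types (u v w : 'I_n) (e : E) (rho : {ffun 'I_n -> E}).

Definition rotor_step rho v := Defs.head (rho v).

Definition flows_to w rho :=
  rotor_config rho && [forall v, fconnect (rotor_step rho) v w].

Lemma rotor_configP rho : reflect (forall v, tail (rho v) = v) (rotor_config rho).
Proof. exact: 'forall_eqP. Qed.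

Lemma flows_toP w rho :
  reflect ((forall v, tail (rho v) = v) /\
           forall v, fconnect (rotor_step rho) v w) (flows_to w rho).
Proof.
by apply: (iffP andP) => [[/rotor_configP ? /forallP]|[? ?]]; split=> //;
  [apply/rotor_configP | apply/forallP].
Qed.

(** [tail] inverts [rho], so directed cycles of rotor edges correspond to vertex cycles of the map
    [rotor_step rho]. *)
Lemma dicycle_rotorP rho (C : {set E}) : (forall v, tail (rho v) = v) ->
  reflect (exists s : seq 'I_n, [/\ s != [::], fcycle (rotor_step rho) s, uniq s
                                  & C = [set rho v | v in s]])
          ((C \subset [set rho v | v : 'I_n]) && dicycle C).
Proof.
move=> tr; have trK : cancel rho (@tail _ D) by [].
apply: (iffP andP) =>
  [[sC /existsP[[p /= szp] /and4P[C0 /eqP Cp cp up]]]|[s [s0 cs us ->]]].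
  have {C0 szp} [C0 {}Cp] : C != set0 /\ C =i p by split=> // e; rewrite Cp inE.
  have rtK : {in p, forall e, rho (tail e) = e}.
    move=> e ep; have : e \in C by rewrite Cp.
    by move=> /(subsetP sC)/imsetP[v _ ->]; rewrite tr.
  have pE : map rho (map (@tail _ D) p) = p.
    by rewrite -map_comp; apply: map_id_in => e /rtK.
  exists (map (@tail _ D) p); split=> //.
  - apply: contraNneq C0 => /(congr1 (map rho)); rewrite pE /= => p0.
    by apply/eqP/setP=> e; rewrite Cp p0 inE.
  - move: cp; rewrite -{1}pE cycle_map; congr is_true; apply: eq_cycle => u v /=.
    by rewrite tr.
  - apply/setP=> e; rewrite Cp -{1}pE; apply/mapP/imsetP => -[v vs ->];
    by exists v.
have sz : size (map rho s) == #|[set rho v | v in s]|.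
  by rewrite size_map card_imset ?(card_uniqP us) //; apply: can_inj trK.
split; first by apply/subsetP=> e /imsetP[v _ ->]; apply: imset_f.
apply/existsP; exists (Tuple sz); apply/and4P; split=> /=.
- case: s s0 {cs us sz} => // v s _; apply/set0Pn; exists (rho v).
  by apply: imset_f; apply: mem_head.
- by apply/eqP/setP=> e; rewrite inE; apply/imsetP/mapP => -[v vs ->]; exists v.
- move: cs; rewrite cycle_map; congr is_true; apply: eq_cycle => u v /=.
  by rewrite tr.
- by rewrite -map_comp (@eq_map _ _ _ id) ?map_id // => v /=; rewrite tr.
Qed.

(** Every vertex of a cycle leads to [w], so [w] lies on it and the cycle is the forward orbit of
    [w]. *)
Lemma flows_to_cycle w rho (s : seq 'I_n) : flows_to w rho ->
  s != [::] -> fcycle (rotor_step rho) s ->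
  forall u, (u \in s) = fconnect (rotor_step rho) w u.
Proof.
move=> /flows_toP[_ fl]; case: s => // v s _ cs u.
have ws : w \in v :: s by rewrite -(fconnect_cycle cs (mem_head v s)).
by rewrite (fconnect_cycle cs ws).
Qed.

Lemma unicycleE w rho : unicycle (w, rho) = flows_to w rho.
Proof.
apply/andP/idP => [[tr /existsP[C /andP[/eqP CE wC]]]|fl].
  have /rotor_configP {}tr := tr; apply/flows_toP; split=> // v.
  have [s [s0 cs us CsE]] : exists s, [/\ s != [::], fcycle (rotor_step rho) s,
       uniq s & C = [set rho v | v in s]].
    by apply/(dicycle_rotorP _ tr); have := set11 C; rewrite -CE inE.
  have ws : w \in s.
    by case/imsetP: wC => e; rewrite CsE => /imsetP[u us' ->] ->; rewrite tr.
  set g := rotor_step rho.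
  (* Some iterate [u] of [v] lies on a cycle, which must be the unique one. *)
  have /trajectP[i lt_i iE] := looping_order g v.
  pose u := iter i g v.
  have vu : fconnect g v u by apply: fconnect_iter.
  apply: connect_trans vu _; rewrite fconnect_orbit.
  have cu : fcycle g (orbit g u).
    apply/(orbitPcycle 3 0); exists (order g v - i).-1.
    by rewrite prednK ?subn_gt0 // -iterD subnK // ltnW.
  have : [set rho v | v in orbit g u] \in rotor_cycles rho.
    rewrite inE; apply/(dicycle_rotorP _ tr); exists (orbit g u); split=> //.
      by rewrite -size_eq0 size_orbit -lt0n order_gt0.
    exact: orbit_uniq.
  rewrite CE inE CsE => /eqP/setP/(_ (rho w)).
  by rewrite !mem_imset //; try exact: can_inj tr; rewrite ws => ->.
have [tr con] := flows_toP _ _ fl; split; first exact/rotor_configP.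
set g := rotor_step rho.
(* The successor of [w] leads back to [w], so the orbit of [w] closes up. *)
have cw : fcycle g (orbit g w).
  by rewrite -fconnect_f; apply: con.
have gw0 : orbit g w != [::] by rewrite -size_eq0 size_orbit -lt0n order_gt0.
apply/existsP; exists [set rho v | v in orbit g w]; apply/andP; split.
  apply/eqP/setP=> C; rewrite !inE; apply/(dicycle_rotorP _ tr)/eqP => [|->].
    move=> [s [s0 cs us ->]]; apply/setP=> e.
    by apply/imsetP/imsetP => -[u us' ->]; exists u => //; move: us';
      rewrite -fconnect_orbit (flows_to_cycle fl s0 cs).
  by exists (orbit g w); split=> //; apply: orbit_uniq.
apply/imsetP; exists (rho w); last by rewrite tr.
by apply: imset_f; rewrite -fconnect_orbit.
Qed.

(** * Spanning in-arborescences as cut rotor configurations *)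

Lemma walk_rotor rho v (p : seq E) :
  (forall e, e \in p -> e = rho (tail e)) -> walk v p ->
  p = [seq rho u | u <- traject (rotor_step rho) v (size p)] /\
  [seq Defs.head e | e <- p] =
    traject (rotor_step rho) (rotor_step rho v) (size p).
Proof.
elim: p v => //= e p IHp v pr /andP[/eqP tev wp].
have eE : e = rho v by rewrite -tev; apply/pr/mem_head.
have [|-> {1}->] := IHp _ _ wp; first by move=> f fp; apply/pr/mem_behead.
by rewrite !size_map !size_traject eE.
Qed.

Lemma walk_traject rho v k : (forall u, tail (rho u) = u) ->
  walk v [seq rho u | u <- traject (rotor_step rho) v k].
Proof. by move=> tr; elim: k v => //= k IHk v; rewrite tr eqxx IHk. Qed.

(** With the rotor at [w] excluded, a path to [w] has to follow the rotors and stop at the first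
    arrival; this makes it unique. *)
Lemma rotor_dipathP rho w v (A P : {set E}) :
  (forall u, tail (rho u) = u) ->
  (forall e, e \in A -> e = rho (tail e) /\ tail e != w) ->
  P \subset A -> dipath v w P ->
  exists k, [/\ iter k (rotor_step rho) v = w,
    forall i, i < k -> iter i (rotor_step rho) v != w &
    P = [set e in [seq rho u | u <- traject (rotor_step rho) v k]]].
Proof.
move=> tr Ar sPA /existsP[[p /= szp] /and4P[/eqP Pp wp lp up]].
have pA e : e \in p -> e = rho (tail e) /\ tail e != w.
  by move=> ep; apply: Ar; apply: (subsetP sPA); rewrite Pp inE.
have Pq : P =i p by move=> e; rewrite Pp inE.
have [|pE hE] := @walk_rotor rho _ _ _ wp; first by move=> e /pA[].
exists (size p); split.
- by move: lp; rewrite hE last_traject => /eqP.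
- move=> i lt_i; have /pA[_] : rho (iter i (rotor_step rho) v) \in p.
    by rewrite pE map_f //; apply/trajectP; exists i.
  by rewrite tr.
- by apply/setP=> e; rewrite inE -pE Pq.
Qed.

Definition cut_rotor w rho : {set E} := [set rho v | v in [pred v | v != w]].

Lemma cut_rotor_tail w rho e : (forall v, tail (rho v) = v) ->
  e \in cut_rotor w rho -> e = rho (tail e) /\ tail e != w.
Proof. by move=> tr /imsetP[v vw ->]; rewrite tr. Qed.

(** A cycle would have to use the rotor at [w], which is cut, and the paths to [w] are the rotor
    trajectories up to the first arrival. *)
Lemma arborescence_cut_rotor w rho : (forall v, tail (rho v) = v) ->
  in_arborescence w (cut_rotor w rho) = flows_to w rho.
Proof.
move=> tr; set A := cut_rotor w rho; set g := rotor_step rho.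
have At e : e \in A -> e = rho (tail e) /\ tail e != w by apply: cut_rotor_tail.
apply/and3P/idP => [[_ /forallP dp _]|fl].
  apply/flows_toP; split=> // v; have [->|vw] := eqVneq v w; first exact: connect0.
  have := dp v; rewrite vw => /cards1P[P PE].
  have := set11 P; rewrite -PE inE => /andP[sPA /(rotor_dipathP tr At sPA)[k [<- _ _]]].
  exact: fconnect_iter.
have [_ con] := flows_toP _ _ fl; split.
- apply/forallP=> C; apply/implyP=> sCA; apply/negP => dC.
  have : (C \subset [set rho v | v : 'I_n]) && dicycle C.
    rewrite dC andbT; apply: subset_trans sCA _; apply/subsetP=> e /imsetP[v _ ->].
    exact: imset_f.
  move=> /(dicycle_rotorP _ tr)[s [s0 cs _ CE]].
  have /(subsetP sCA)/At[_] : rho w \in C.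
    by rewrite CE imset_f // (flows_to_cycle fl s0 cs) connect0.
  by rewrite tr eqxx.
- apply/forallP=> v; apply/implyP=> vw.
  have ex : exists k, iter k g v == w.
    by exists (findex g v w); rewrite iter_findex.
  case: (ex_minnP ex) => k /eqP kw kmin.
  have kneq i : i < k -> iter i g v != w.
    by move=> lt_i; apply: contraL lt_i => /kmin; rewrite leqNgt.
  pose p := [seq rho u | u <- traject g v k].
  have hE : v :: [seq Defs.head e | e <- p] = traject g v k.+1.
    have pr e : e \in p -> e = rho (tail e) by move=> /mapP[u _ ->]; rewrite tr.
    have [_ ->] := walk_rotor pr (walk_traject v k tr).
    by rewrite size_map size_traject.
  have up : uniq (v :: [seq Defs.head e | e <- p]).
    (* Only the endpoint [w] has to be checked: it does not occur earlier, by minimality of [k]. *)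
    rewrite hE looping_uniq /looping kw.
    by apply/negP => /trajectP[i /kneq iw wE]; rewrite -wE eqxx in iw.
  apply/cards1P; exists [set e in p]; apply/setP=> P; rewrite !inE.
  apply/andP/eqP => [[sPA /(rotor_dipathP tr At sPA)[j [jw jmin ->]]]|->].
    suff -> : j = k by [].
    by case: (ltngtP j k) => // [/kneq|/jmin]; rewrite ?jw ?kw eqxx.
  split.
    apply/subsetP=> e; rewrite inE => /mapP[u /trajectP[i lt_i ->] ->].
    by apply: imset_f; rewrite inE kneq.
  have sz : size p == #|[set e in p]|.
    rewrite cardsE; apply/eqP/esym/card_uniqP; move: up => /andP[_].
    exact: map_uniq.
  apply/existsP; exists (Tuple sz); apply/and4P; split=> //=.
  + exact: walk_traject.
  + have -> : last v [seq Defs.head e | e <- p]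
      = last v (v :: [seq Defs.head e | e <- p]) by [].
    by rewrite hE /= last_traject kw.
- apply/forallP=> v; apply/eqP; have [->|vw] := eqVneq v w.
    apply/eqP; rewrite cards_eq0; apply/eqP/setP=> e; rewrite !inE.
    by apply/negP => /andP[/At[_ /negbTE ->]].
  apply/eqP/cards1P; exists (rho v); apply/setP=> e; rewrite !inE.
  apply/andP/eqP => [[/At[-> _] /eqP <-]|->]; first by rewrite tr.
  by rewrite tr imset_f.
Qed.

Lemma cut_rotor_inj w rho1 rho2 :
  (forall v, tail (rho1 v) = v) -> (forall v, tail (rho2 v) = v) ->
  rho1 w = rho2 w -> cut_rotor w rho1 = cut_rotor w rho2 -> rho1 = rho2.
Proof.
move=> tr1 tr2 ew ecut; apply/ffunP=> v; have [->//|vw] := eqVneq v w.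
have : rho1 v \in cut_rotor w rho2 by rewrite -ecut imset_f.
by move=> /(cut_rotor_tail tr2)[-> _]; rewrite tr1.
Qed.

(** Once the rotor at [w] is fixed to be [e], cutting is injective, and adding [e] to an
    arborescence inverts it. *)
Lemma num_arborescencesE w e : tail e = w ->
  num_arborescences D w = #|[set rho | flows_to w rho & rho w == e]|.
Proof.
move=> te; rewrite -(card_in_imset (f := cut_rotor w)); last first.
  move=> rho1 rho2; rewrite !inE => /andP[/flows_toP[tr1 _] /eqP e1].
  move=> /andP[/flows_toP[tr2 _] /eqP e2].
  by apply: cut_rotor_inj => //; rewrite e1.
apply: eq_card => A; rewrite inE; apply/idP/imsetP; last first.
  move=> [rho]; rewrite inE => /andP[fl _ ->].
  by have [tr _] := flows_toP _ _ fl; rewrite arborescence_cut_rotor.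
move=> arbA; have /and3P[_ _ /forallP degA] := arbA.
(* No edge of [A] leaves [w], so the default [e] becomes the rotor there. *)
pose rho := [ffun v => odflt e [pick f in A | tail f == v]].
have rhoA v : v != w -> [set f in A | tail f == v] = [set rho v].
  move=> vw; have := degA v; rewrite vw => /cards1P[f fE]; rewrite fE ffunE.
  case: pickP => [g|/(_ f)] /=; last first.
    by have := set11 f; rewrite -fE inE => ->.
  by rewrite -[_ && _](in_set (fun g => (g \in A) && (tail g == v))) fE => /set1P->.
have rhow : rho w = e.
  rewrite ffunE; case: pickP => //= f fA; have := degA w.
  by rewrite eqxx cards_eq0 => /eqP/setP/(_ f); rewrite !inE fA.
have tr v : tail (rho v) = v.
  have [->|vw] := eqVneq v w; first by rewrite rhow.
  by have := set11 (rho v); rewrite -rhoA // inE => /andP[_ /eqP].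
have AE : A = cut_rotor w rho.
  apply/setP=> f; apply/idP/imsetP => [fA|[v vw ->]]; last first.
    by have := set11 (rho v); rewrite -rhoA // inE => /andP[].
  have tfw : tail f != w.
    apply/negP=> /eqP tf; have := degA w.
    by rewrite eqxx cards_eq0 => /eqP/setP/(_ f); rewrite !inE fA tf eqxx.
  exists (tail f) => //; apply/eqP; rewrite -in_set1 -rhoA // inE fA /=.
  exact: eqxx.
exists rho => //; rewrite inE rhow eqxx andbT.
by rewrite -(arborescence_cut_rotor w tr) -AE.
Qed.

End RotorGraph.

Lemma leq_sum_ord (F : nat -> nat) a b : a <= b ->
  \sum_(k < a) F k <= \sum_(k < b) F k.
Proof. by move=> /subnKC <-; rewrite big_split_ord leq_addr. Qed.

(** * Rotor turns and the rotor-router step *)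

Section RotorRouter.
Variables (n : nat) (D : digraph n) (next : edge D -> edge D).
Hypothesis next_cyclic : cyclic_ordering next.
Local Notation E := (edge D).
Local Notation R := (rotor_router next).
Implicit Types (u v w y : 'I_n) (e : E) (rho : {ffun 'I_n -> E}).
Implicit Types (c : chip_rotor D).

Lemma tail_next e : tail (next e) = tail e.
Proof. by apply/eqP; rewrite -next_cyclic fconnect1. Qed.

Lemma iter_order_next e : iter (order next e) next e = e.
Proof.
by apply/(orbitPcycle 2 4); rewrite -topredE /= next_cyclic tail_next.
Qed.

Lemma order_next e : order next e = outdeg D (tail e).
Proof. by apply: eq_card => f; rewrite !inE -next_cyclic. Qed.

Lemma iter_turns m e : iter (m * outdeg D (tail e)) next e = e.
Proof. by rewrite -order_next iter_mul_period ?iter_order_next. Qed.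

(** A full turn uses every out-edge once. The index is [k.+1] because the rotor advances before the
    chip moves along it. *)
Lemma turn_heads m e y :
  \sum_(k < m * outdeg D (tail e)) (Defs.head (iter k.+1 next e) == y)
    = m * mult D (tail e) y.
Proof.
under eq_bigr => k _ do rewrite iterSr.
rewrite -tail_next -order_next.
rewrite (sum_iter_order (fun f => Defs.head f == y)) ?iter_order_next //.
by congr (_ * _); apply: eq_card => f; rewrite !inE next_cyclic.
Qed.

Lemma turn_edge m e f : tail f = tail e ->
  \sum_(k < m * outdeg D (tail e)) (iter k next e == f) = m.
Proof.
move=> tf; rewrite -order_next (sum_iter_order (pred1 f)) ?iter_order_next //.
rewrite (@eq_card1 _ f) ?muln1 // => g; rewrite !inE next_cyclic.
by case: (eqVneq g f) => [->|_]; rewrite ?tf ?eqxx ?andbF.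
Qed.

(** Only the rotor at [w] changes: old paths survive up to their first arrival at [w], and the new
    rotor leads on to the new chip position. *)
Lemma flows_to_step c : flows_to c.1 c.2 -> flows_to (R c).1 (R c).2.
Proof.
case: c => w rho /= /flows_toP[tr con]; apply/flows_toP.
set rho' := finfun _; split=> [v|v].
  by rewrite ffunE; case: eqP => [->|_]; rewrite ?tail_next tr.
have w1 : fconnect (rotor_step rho') w (Defs.head (next (rho w))).
  by have := fconnect1 (rotor_step rho') w; rewrite {2}/rotor_step ffunE eqxx.
apply: connect_trans w1; have := iter_findex (con v).
move: {1}(findex (rotor_step _) _ _) => k.
elim: k v => [v /= ->|k IHk v]; first exact: connect0.
rewrite iterSr => /IHk vw; have [->|nvw] := eqVneq v w; first exact: connect0.
apply: connect_trans vw; have := fconnect1 (rotor_step rho') v.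
by rewrite {2}/rotor_step ffunE (negbTE nvw).
Qed.

Lemma flows_to_iter i c : flows_to c.1 c.2 ->
  flows_to (iter i R c).1 (iter i R c).2.
Proof. by move=> fl; elim: i => //= i; apply: flows_to_step. Qed.

(** * Departures and arrivals of the chip *)

(** Departures: the starting position counts, the position at time [i] does not. For the arrivals in
    [entries] it is the other way round. *)
Definition visits c i u := \sum_(j < i) ((iter j R c).1 == u).

Definition entries c i y := \sum_(j < i) ((iter j.+1 R c).1 == y).

Lemma visitsS c i u : visits c i.+1 u = visits c i u + ((iter i R c).1 == u).
Proof. by rewrite /visits big_ord_recr. Qed.

(** Both sides count the times from 0 to [i] at which the chip is at [y]. *)
Lemma entries_balance c i y :
  (c.1 == y) + entries c i y = visits c i y + ((iter i R c).1 == y).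
Proof. by rewrite -visitsS /visits big_ord_recl. Qed.

Lemma iter_rotor c i u : (iter i R c).2 u = iter (visits c i u) next (c.2 u).
Proof.
elim: i => [|i]; first by rewrite /visits big_ord0.
rewrite visitsS iterS; case: (iter i R c) => w rho /= IHi.
by rewrite ffunE eq_sym; case: eqP => [wu|_]; rewrite ?addn1 ?addn0 //= -IHi ?wu.
Qed.

(** Groups the steps by the vertex of the chip: after [k] departures from [u], its rotor has
    advanced exactly [k] times. *)
Lemma sum_along_run (F : 'I_n -> E -> nat) c i :
  \sum_(j < i) F (iter j R c).1 ((iter j R c).2 (iter j R c).1)
    = \sum_u \sum_(k < visits c i u) F u (iter k next (c.2 u)).
Proof.
elim: i => [|i IHi].
  by rewrite big_ord0 big1 // => u _; rewrite /visits !big_ord0.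
rewrite big_ord_recr /= IHi iter_rotor; set v := (iter i R c).1.
rewrite (bigD1 v) //= [RHS](bigD1 v) //= addnAC; congr (_ + _).
  by rewrite visitsS eqxx addn1 big_ord_recr.
by apply: eq_bigr => u uv; rewrite visitsS -/v eq_sym (negbTE uv) addn0.
Qed.

Lemma sum_visits c i : \sum_u visits c i u = i.
Proof.
have := sum_along_run (fun _ _ => 1) c i; rewrite sum1_card card_ord => {2}->.
by apply: eq_bigr => u _; rewrite sum1_card card_ord.
Qed.

Lemma entriesE c i y : entries c i y =
  \sum_u \sum_(k < visits c i u) (Defs.head (iter k.+1 next (c.2 u)) == y).
Proof.
rewrite -(sum_along_run (fun _ e => Defs.head (next e) == y : nat)).
by apply: eq_bigr => j _; rewrite iterS; case: (iter j R c).
Qed.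

(** * The period of a unicycle *)

Section Period.
Variable p : 'I_n -> nat.
Hypothesis p_gt0 : forall v, 0 < p v.
Hypothesis p_prim : forall d, (forall v, d %| p v) -> d = 1.
Hypothesis p_flow : forall y, \sum_u p u * mult D u y = p y * outdeg D y.
Hypothesis outdeg_gt0 : forall v, 0 < outdeg D v.

Definition period := \sum_u p u * outdeg D u.

Variable c : chip_rotor D.
Hypothesis fl : flows_to c.1 c.2.

Lemma full_entries u y :
  \sum_(k < p u * outdeg D u) (Defs.head (iter k.+1 next (c.2 u)) == y)
    = p u * mult D u y.
Proof.
have [tr _] := flows_toP _ _ fl.
by have := turn_heads (p u) (c.2 u) y; rewrite tr.
Qed.

(** Within its quota, [u] sends at most [p u * mult D u y] chips to [y]; by [p_flow] these bounds
    add up to the quota of [y]. *)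
Lemma entries_le i y : (forall u, visits c i u <= p u * outdeg D u) ->
  entries c i y <= p y * outdeg D y.
Proof.
move=> le; rewrite entriesE -p_flow; apply: leq_sum => u _.
rewrite -full_entries.
exact: (@leq_sum_ord (fun k => Defs.head (iter k.+1 next (c.2 u)) == y : nat)).
Qed.

(** The initial rotor is the last edge of every turn, so an unfinished quota at [u] lacks at least
    one chip sent along it. *)
Lemma entries_lt i u : (forall u, visits c i u <= p u * outdeg D u) ->
  visits c i u < p u * outdeg D u ->
  entries c i (rotor_step c.2 u) <
    p (rotor_step c.2 u) * outdeg D (rotor_step c.2 u).
Proof.
set y := rotor_step c.2 u => le lt_u; rewrite entriesE -p_flow.
have le1 v : \sum_(k < visits c i v) (Defs.head (iter k.+1 next (c.2 v)) == y)
   <= p v * mult D v y.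
  rewrite -full_entries.
  exact: (@leq_sum_ord (fun k => Defs.head (iter k.+1 next (c.2 v)) == y : nat)).
rewrite (bigD1 u) //= [ltnRHS](bigD1 u) //= -addSn leq_add //; last first.
  by apply: leq_sum => v _; apply: le1.
rewrite -full_entries; case mE: (p u * outdeg D u) lt_u => [|m] //.
rewrite ltnS => le_m; rewrite big_ord_recr /=.
(* The last departure of the quota, with index [m], goes along the initial rotor. *)
have -> : next (iter m next (c.2 u)) = c.2 u.
  have [tr _] := flows_toP _ _ fl; rewrite -iterS -mE.
  by have := iter_turns (p u) (c.2 u); rewrite tr.
rewrite eqxx addn1 ltnS.
exact: (@leq_sum_ord (fun k => Defs.head (iter k.+1 next (c.2 u)) == y : nat)).
Qed.

Lemma iter_period :
  iter period R c = c /\ forall u, visits c period u = p u * outdeg D u.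
Proof.
pose M u := p u * outdeg D u; pose chip i := (iter i R c).1.
have bounded i : (forall j, j < i -> visits c j (chip j) < M (chip j)) ->
    forall u, visits c i u <= M u.
  elim: i => [|i IHi] lt u; first by rewrite /visits big_ord0.
  have {}IHi : visits c i u <= M u.
    by apply: IHi => j lt_j; apply: lt; apply: ltnW.
  rewrite visitsS; case: eqP => [<-|_]; last by rewrite addn0.
  by rewrite addn1; apply: lt.
(* Otherwise [period.+1] departures would fit into quotas that add up to [period]. *)
have ex : exists i, M (chip i) <= visits c i (chip i).
  case: (boolP [exists i : 'I_period.+1, M (chip i) <= visits c i (chip i)]).
    by case/existsP=> i; exists i.
  rewrite negb_exists => /forallP nex; have := sum_visits c period.+1.
  have le : \sum_u visits c period.+1 u <= period.
    apply: leq_sum => u _; apply: bounded => j lt_j.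
    by have := nex (Ordinal lt_j); rewrite -ltnNge.
  by move=> sE; rewrite sE ltnn in le.
(* [t] is the first time at which the chip stands on a vertex with exhausted quota. *)
case: (ex_minnP ex) => t Mt tmin {ex}.
have le_t : forall u, visits c t u <= M u.
  apply: bounded => j lt_j; rewrite ltnNge.
  by apply: contraL lt_j => /tmin; rewrite leqNgt.
have visE : visits c t (chip t) = M (chip t) by apply/eqP; rewrite eqn_leq le_t.
(* At any other vertex, the chip would have arrived once more than it left, exceeding the bound on
   arrivals. *)
have chip_t : chip t = c.1.
  have := entries_balance c t (chip t); rewrite -/(chip t) eqxx visE.
  have := entries_le (chip t) le_t; case: (eqVneq c.1 (chip t)) => // _.
  by rewrite add0n => le sE; rewrite sE addn1 ltnn in le.
have entE y : entries c t y = visits c t y.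
  have := entries_balance c t y; rewrite -/(chip t) chip_t addnC.
  exact: addIn.
(* A vertex [u] short of [p u] full turns has not used its initial rotor, the
   last edge of each turn, often enough, so the head of that rotor is short of
   full turns as well; following the initial rotors leads to [c.1]. *)
have visM u : visits c t u = M u.
  have [tr con] := flows_toP _ _ fl; have := iter_findex (con u).
  move: {1}(findex (rotor_step _) _ _) => k.
  elim: k u => [u /= ->|k IHk u]; first by rewrite -chip_t.
  rewrite iterSr => /IHk gu; apply/eqP; rewrite eqn_leq le_t /= leqNgt.
  by apply/negP => /(entries_lt le_t) /=; rewrite entE gu ltnn.
have tE : t = period by rewrite -(sum_visits c t); apply: eq_bigr.
rewrite -tE; split=> //; apply/eqP; rewrite -pair_eqE /= -/(chip t) chip_t eqxx.
apply/eqP/ffunP => u; rewrite iter_rotor visM.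
have [tr _] := flows_toP _ _ fl.
by have := iter_turns (p u) (c.2 u); rewrite tr.
Qed.

Lemma visitsD i j u : visits c (i + j) u = visits c i u + visits (iter i R c) j u.
Proof.
rewrite /visits big_split_ord; congr (_ + _).
by apply: eq_bigr => k _ /=; rewrite addnC iterD.
Qed.

Lemma visits_mul m t u : iter t R c = c -> visits c (m * t) u = m * visits c t u.
Proof.
move=> tc; elim: m => [|m IHm]; first by rewrite /visits big_ord0.
by rewrite !mulSn visitsD tc IHm.
Qed.

Lemma order_rotor_router : order R c = period.
Proof.
have [Nc vN] := iter_period.
have /dvdnP[q qE] := order_dvd_iter Nc.
have tc : iter (order R c) R c = c.
  apply/(orbitPcycle 3 4); exists period.-1; rewrite prednK //.
  rewrite /period (bigD1 c.1) //= ltn_addr // muln_gt0 p_gt0.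
  exact: outdeg_gt0.
suff q1 : q = 1 by rewrite qE q1 mul1n.
apply: p_prim => u; have [tr _] := flows_toP _ _ fl.
(* One orbit brings the rotor at [u] back, so the departures from [u] form whole turns; comparing
   with [p u] turns gives that [q] divides [p u]. *)
have : order next (c.2 u) %| visits c (order R c) u.
  by apply: order_dvd_iter; rewrite -iter_rotor tc.
rewrite order_next tr => /dvdnP[k kE].
have := vN u; rewrite qE visits_mul // kE mulnA => /eqP.
by rewrite eqn_pmul2r // => /eqP <-; apply: dvdn_mulr.
Qed.

(** The forward orbit is a cycle, so each of its members generates it. *)
Lemma rr_orbit_eq c' : fconnect R c c' -> rr_orbit next c' = rr_orbit next c.
Proof.
have cyc_c : fcycle R (orbit R c).
  by apply/(orbitPcycle 4 0); rewrite order_rotor_router; case: iter_period.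
rewrite fconnect_orbit => c'in; apply/setP=> d; rewrite !inE.
by rewrite (fconnect_cycle cyc_c c'in) fconnect_orbit.
Qed.

(** In one period [w] makes [p w] full turns, each showing [e] under the chip once, and every
    configuration of the orbit occurs once. *)
Lemma card_orbit_rotor w e : tail e = w ->
  #|[set c' in rr_orbit next c | (c'.1 == w) && (c'.2 w == e)]| = p w.
Proof.
move=> te; have [Nc vN] := iter_period.
have := @sum_iter_order _ R [pred c' : chip_rotor D | (c'.1 == w) && (c'.2 w == e)] 1 c.
rewrite order_rotor_router => /(_ Nc); rewrite !mul1n => cE.
transitivity (\sum_(k < period) ((iter k R c).1 == w) && ((iter k R c).2 w == e)).
  by rewrite cE; apply: eq_card => c'; rewrite !inE.
have := sum_along_run (fun v f => (v == w) && (f == e) : nat) c period.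
rewrite (eq_bigr (fun k : 'I_period =>
    ((iter k R c).1 == w) && ((iter k R c).2 w == e) : nat)).
  move=> ->; rewrite (bigD1 w) //= [X in _ + X = _]big1 ?addn0 => [|u uw].
    rewrite vN; have [tr _] := flows_toP _ _ fl.
    under eq_bigr => k _ do rewrite eqxx /=.
    by have := @turn_edge (p w) (c.2 w) e; rewrite tr; apply.
  by rewrite big1 // => k _; rewrite (negbTE uw).
by move=> k _; case: eqP => [->|].
Qed.

End Period.
End RotorRouter.

(** * From the Laplacian kernel to a conservation law *)

(** Passes to natural numbers and to a balance with loops on both sides, which is what counting chip
    moves requires. *)
Lemma is_per_flow n (D : digraph n) (per : 'cV[int]_n) : is_per D per ->
  exists p : 'I_n -> nat,
    [/\ forall v, per v 0%R = (p v)%:Z, forall v, 0 < p v,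
        forall d, (forall v, d %| p v) -> d = 1
      & forall y, \sum_u p u * mult D u y = p y * outdeg D y].
Proof.
move=> [per_gt0 per_prim per_ker]; pose p v := `|per v 0%R|%N.
have pE v : per v 0%R = (p v)%:Z by rewrite /p gez0_abs // ltW.
have p_gt0 v : 0 < p v by rewrite -ltz_nat -pE.
exists p; split=> //.
  move=> d dp; have := per_prim d%:Z; rewrite [`|_|%R]/= => per_d.
  have [] : (d%:Z = 1)%R; last by [].
  by apply: per_d => v; rewrite pE; apply: dp.
(* Row [y] of the kernel equation: the sum leaves out the loops at [y], the out-degree includes
   them. *)
have offdiag y : \sum_(u | u != y) p u * mult D u y = p y * outdeg D y.
  have := congr1 (fun M : 'cV_n => M y 0%R) per_ker.
  rewrite !mxE (bigD1 y) //= mxE eqxx pE mulNr => /eqP.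
  rewrite addrC subr_eq0 => /eqP H; apply/eqP; rewrite -eqz_nat; apply/eqP.
  rewrite -natz natr_sum PoszM mulrC -H; apply: eq_bigr => u uy.
  by rewrite mxE eq_sym (negbTE uy) pE natz PoszM mulrC.
have degE u : outdeg D u = \sum_y mult D u y.
  rewrite /outdeg -sum1_card (partition_big (@Defs.head _ D) xpredT) //=.
  apply: eq_bigr => y _; rewrite sum1dep_card.
  by apply: eq_card => e; rewrite !inE.
(* The Laplacian ignores loops, so summing its rows gives minus the number of
   loops in each column: a positive kernel vector excludes loops. *)
have loopless : \sum_y p y * mult D y y = 0.
  apply/eqP; rewrite -(eqn_add2r (\sum_y p y * outdeg D y)) add0n -big_split /=.
  apply/eqP; transitivity (\sum_y \sum_u p u * mult D u y).
    by apply: eq_bigr => y _; rewrite -offdiag [RHS](bigD1 y).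
  by rewrite exchange_big /=; apply: eq_bigr => u _; rewrite degE big_distrr.
move=> y; rewrite (bigD1 y) //= offdiag -[RHS]add0n; congr (_ + _).
by move/eqP: loopless; rewrite sum_nat_eq0 => /forallP/(_ y)/eqP.
Qed.

Local Open Scope ring_scope.

(** * Double counting of unicycles with prescribed chip and rotor *)

Theorem theorem3 (n : nat) (D : digraph n) (next : edge D -> edge D)
    (per : 'cV[int]_n) :
  strongly_connected D ->
  (forall v : 'I_n, 0 < outdeg D v)%N ->
  cyclic_ordering next ->
  is_per D per ->
  forall w : 'I_n,
    #|unicycle_orbits next|%:R
      = (num_arborescences D w)%:R / (per w 0)%:~R :> rat.
Proof.
move=> _ deg cyc /is_per_flow[p [pE p_gt0 p_prim p_flow]] w.
suff -> : num_arborescences D w = (#|unicycle_orbits next| * p w)%N.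
  rewrite pE natrM -pmulrn mulfK // pnatr_eq0 -lt0n.
  exact: p_gt0.
have /card_gt0P[e] : (0 < #|[set e : edge D | tail e == w]|)%N by apply: deg.
rewrite inE => /eqP te; rewrite (num_arborescencesE te).
(* [S] is counted twice: through arborescences completed by [e], and orbit by orbit. *)
pose S := [set c : chip_rotor D | unicycle c & (c.1 == w) && (c.2 w == e)].
transitivity #|S|.
  rewrite -(card_imset _ (f := pair w)); last by move=> ? ? [].
  apply: eq_card => -[v rho]; rewrite !inE; apply/imsetP/and3P.
    move=> [rho']; rewrite inE => /andP[fl rw] [-> ->].
    by split; rewrite ?unicycleE /=.
  rewrite unicycleE => -[fl /= /eqP vw rw].
  by exists rho; rewrite ?vw // inE rw -vw fl.
have uniP c : unicycle c = flows_to c.1 c.2 by case: c => ? ?; apply: unicycleE.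
(* Each orbit contributes [p w] members of [S]. *)
rewrite -sum1_card (partition_big (rr_orbit next) (mem (unicycle_orbits next))).
  rewrite -sum_nat_const; apply: eq_bigr => _ /imsetP[c uc ->].
  have fl : flows_to c.1 c.2 by rewrite -uniP.
  rewrite sum1dep_card -(card_orbit_rotor cyc p_gt0 p_prim p_flow deg fl te).
  apply: eq_card => c'; rewrite !inE.
  rewrite uniP; case: (boolP (fconnect _ c c')) => [cc'|ncc'] /=.
    rewrite (rr_orbit_eq cyc p_gt0 p_prim p_flow deg fl cc') eqxx andbT.
    by rewrite -(iter_findex cc') flows_to_iter.
  apply/negbTE; apply: contra ncc' => /andP[_ /eqP/setP/(_ c')].
  by rewrite !inE connect0 => <-.
move=> c; rewrite inE => /andP[uc _]; exact: imset_f.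
Qed.
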